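(* Let $n\ge1$, $0\le k\le n$ and $0\le r<n$ be integers. If $n$ or $k$ is odd, then $|\bar S_r(n,k)| = |N_r(n,k)|$. Consequently, if $n$ is odd then $|\bar S_r(n)| = |N_r(n)|$, where $\bar S_r(n)=\bigcup_{k=0}^n\bar S_r(n,k)$ and $N_r(n)=\bigcup_{k=0}^n N_r(n,k)$.
   Context: $\bar S_r(n,k)$ is the set of $k$-element subsets of $[n]=\{1,\dots,n\}$ the sum of whose elements is congruent to $r$ modulo $n$. A binary necklace of length $n$ is an equivalence class of words in $\{0,1\}^n$ under cyclic rotation. A word $u$ has co-period $j$ if $u=v^j$ with $v$ primitive (not a power $w^i$ with $i\ge2$); all words of a necklace share this co-period. $N_r(n,k)$ is the set of binary necklaces of length $n$ with exactly $k$ ones whose co-period divides $r$ (every positive integer divides $0$, so $N_0(n,k)$ is the set of all such necklaces). *)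

(* Defs.v *)
From mathcomp Require Import all_boot.
From mathcomp Require Import boolp.

Set Implicit Arguments.
Unset Strict Implicit.
Unset Printing Implicit Defensive.

(* The ordinal i : 'I_n, of value 0 <= i < n, stands for the element i.+1 of
   [n] = {1, ..., n}. *)
Definition Sbar_k (r n k : nat) : {set {set 'I_n}} :=
  [set A : {set 'I_n} | (#|A| == k) && (\sum_(i in A) i.+1 == r %[mod n])].

Definition Sbar (r n : nat) : {set {set 'I_n}} :=
  \bigcup_(k < n.+1) Sbar_k r n k.

Definition word_pow (T : Type) (w : seq T) (i : nat) : seq T :=
  flatten (nseq i w).

(* The empty word is its own square, hence not primitive. *)
Definition primitive_word (T : Type) (v : seq T) : Prop :=
  forall (w : seq T) (i : nat), 2 <= i -> v <> word_pow w i.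

Definition has_coperiod (T : Type) (u : seq T) (j : nat) : Prop :=
  exists2 v : seq T, primitive_word v & u = word_pow v j.

Definition rotation (n : nat) : rel (n.-tuple bool) :=
  fun u v => [exists i : 'I_n.+1, v == [tuple of rot i u]].

Lemma rotationP (n : nat) (u v : n.-tuple bool) :
  reflect (exists2 i : nat, i <= n & tval v = rot i u) (rotation u v).
Proof.
apply: (iffP existsP) => [[i /eqP ->]|[i lein def_v]].
  by exists i; rewrite // -ltnS.
have ltin : i < n.+1 by [].
by exists (Ordinal ltin); apply/eqP/val_inj.
Qed.

Lemma rotation_equiv (n : nat) : equivalence_rel (@rotation n).
Proof.
have rot_sym u v : @rotation n u v -> rotation v u.
  case/rotationP=> i lein def_v; apply/rotationP.
  exists (n - i); first exact: leq_subr.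
  by rewrite def_v -[X in X - i](size_tuple u) -(size_rot i) -/(rotr i _) rotK.
have rot_trans u v w : @rotation n u v -> rotation v w -> rotation u w.
  case/rotationP=> i _ def_v /rotationP[j _ def_w]; apply/rotationP.
  exists (rot_add u i j); last by rewrite def_w def_v rot_rot_add.
  by rewrite -[X in _ <= X](size_tuple u) leq_rot_add.
move=> u v w; split=> [|uv]; first by apply/rotationP; exists 0; rewrite ?rot0.
by apply/idP/idP; [apply: rot_trans; apply: rot_sym | apply: rot_trans].
Qed.

Definition necklaces (n : nat) : {set {set n.-tuple bool}} :=
  equivalence_partition (@rotation n) [set: n.-tuple bool].

Definition necklace_coperiod (n : nat) (X : {set n.-tuple bool}) (j : nat) :
    Prop :=
  forall u : n.-tuple bool, u \in X -> has_coperiod u j.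

Definition N_k (r n k : nat) : {set {set n.-tuple bool}} :=
  [set X in necklaces n |
    [forall (u | u \in X), count_mem true u == k] &&
    `[< exists2 j : nat, necklace_coperiod X j & j %| r >]].

Definition N_all (r n : nat) : {set {set n.-tuple bool}} :=
  \bigcup_(k < n.+1) N_k r n k.

(* Main.v *)
Require Import Defs.
From mathcomp Require Import all_boot all_algebra all_field.
Import GRing.Theory Num.Theory.

(* Let z be a primitive n-th root of unity.  Both n * |Sbar_r(n,k)| and
   n * |N_r(n,k)| have the form sum_(t < n) z^(t(n-r)) a_t.  For subsets,
   a_t is the sum of z^(t * sum A) over the k-subsets A, which is the
   coefficient of X^(n-k) in prod_(1 <= i <= n) (X + z^(ti)).  For necklaces,
   a_t counts the words with k ones fixed by rotation by t: the rotations
   fixing a word of co-period j are the multiples of n/j, so they contribute j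
   if j divides r and 0 otherwise, and j is also the weight for which every
   necklace has total weight n.  With g = gcd(t,n) and d = n/g, the two
   coefficients are those of X^(n-k) in (X^d - (-1)^d)^g and (X^d + 1)^g.  They
   agree when d is odd; when d is even, n is even, hence k and n-k are odd, and
   both coefficients vanish. *)

Set Implicit Arguments.
Unset Strict Implicit.
Unset Printing Implicit Defensive.

(** * Orbits of an injective map, and words fixed by a rotation *)

Lemma eq_iter_order (T : finType) (f : T -> T) (t : nat) (x : T) :
  injective f -> (iter t f x == x) = (order f x %| t).
Proof.
move=> injf; set p := order f x.
have iterM q : iter (q * p) f x = x.
  by elim: q => //= q IHq; rewrite mulSn iterD IHq iter_order.
rewrite {1}(divn_eq t p) addnC iterD iterM /dvdn.
have ltsp : t %% p < p by rewrite ltn_mod order_gt0.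
(* Below the order, [findex] recovers the number of steps, so a return to [x] forces the remainder
   of [t] to be 0. *)
apply/eqP/eqP => [fix_s|->] //.
by rewrite -(findex_iter ltsp) fix_s findex0.
Qed.

(** Comparing the first [size a] letters of both sides shows that [b] begins with [a]; what remains
    of [b] still commutes with [a], so induction on [q] applies. *)
Lemma flatten_nseq_of_commute (T : eqType) (a b : seq T) (q : nat) :
  size b = q * size a -> b ++ a = a ++ b -> b = flatten (nseq q a).
Proof.
elim: q b => [|q IHq] b /=; first by move/size0nil.
rewrite mulSn => szb eq_ba.
have szab : size a <= size b by rewrite szb leq_addr.
have def_b : b = a ++ drop (size a) b.
  have := congr1 (take (size a)) eq_ba.
  by rewrite takel_cat // take_size_cat // => eqa; rewrite -{1}eqa cat_take_drop.
rewrite {1}def_b; congr (_ ++ _); apply: IHq; first by rewrite size_drop szb addKn.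
move: eq_ba; rewrite {1 2}def_b -catA => /eqP.
by rewrite eqseq_cat // => /andP[_ /eqP].
Qed.

Lemma rot_flatten_nseq (T : Type) (a : seq T) (q : nat) :
  rot (size a) (flatten (nseq q a)) = flatten (nseq q a).
Proof.
case: q => [|q] //=; rewrite rot_size_cat.
by elim: q => [|q IHq] /=; rewrite ?cats0 // -catA IHq.
Qed.

Lemma size_flatten_nseq (T : Type) (a : seq T) (q : nat) :
  size (flatten (nseq q a)) = q * size a.
Proof. by rewrite size_flatten /shape map_nseq sumn_nseq mulnC. Qed.

Lemma flatten_nseqM (T : Type) (a : seq T) (q i : nat) :
  flatten (nseq q (flatten (nseq i a))) = flatten (nseq (q * i) a).
Proof. by elim: q => //= q ->; rewrite mulSn nseqD flatten_cat. Qed.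

(** Cutting [s] after [g] letters turns invariance under rotation into commutation of the two
    pieces. For [g = 0], divisibility forces [s] to be empty. *)
Lemma rot_fixed_flatten (T : eqType) (s : seq T) (g : nat) :
  g %| size s -> rot g s = s -> s = flatten (nseq (size s %/ g) (take g s)).
Proof.
case: (posnP g) => [->|g0]; first by rewrite dvd0n => /eqP/size0nil ->.
case/dvdnP=> -[|q] szs; first by rewrite (size0nil szs) /= div0n.
move=> eq_rot; have -> : size s %/ g = q.+1 by rewrite szs mulnK.
have ltgs : g <= size s by rewrite szs mulSn leq_addr.
have szt : size (take g s) = g by rewrite size_takel.
rewrite /= -{1}(cat_take_drop g s); congr (_ ++ _); apply: flatten_nseq_of_commute.
  by rewrite size_drop szs szt mulSn addKn.
by rewrite -{2}(rotK g s) cat_take_drop -[RHS]eq_rot; rewrite rotK.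
Qed.

(** * Rotation by one letter: its orbits are the necklaces, its orders give the co-periods *)

Definition rot1 (n : nat) (u : n.-tuple bool) : n.-tuple bool :=
  [tuple of rot 1 u].

Lemma rot1_inj (n : nat) : injective (@rot1 n).
Proof. by move=> u v /(congr1 val) /= /rot_inj/val_inj. Qed.

Lemma iter_rot1 (n t : nat) (u : n.-tuple bool) :
  t <= n -> val (iter t (@rot1 n) u) = rot t u.
Proof.
elim: t => [|t IHt] letn; first by rewrite /= rot0.
by rewrite /= IHt 1?ltnW // [RHS]rotS // size_tuple.
Qed.

Lemma order_rot1_dvd (n : nat) (u : n.-tuple bool) : order (@rot1 n) u %| n.
Proof.
rewrite -eq_iter_order; last exact: rot1_inj.
by apply/eqP/val_inj; rewrite iter_rot1 //= rot_oversize ?size_tuple.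
Qed.

Lemma rot_order_rot1 (n : nat) (u : n.-tuple bool) (t : nat) :
  t <= n -> (rot t u == u) = (order (@rot1 n) u %| t).
Proof.
by move=> letn; rewrite -(iter_rot1 u letn) -eq_iter_order //; exact: rot1_inj.
Qed.

Lemma rotation_fconnect (n : nat) (u v : n.-tuple bool) :
  rotation u v = fconnect (@rot1 n) u v.
Proof.
apply/rotationP/idP => [[i lein def_v]|uv].
  suff ->: v = iter i (@rot1 n) u by apply: fconnect_iter.
  by apply: val_inj; rewrite iter_rot1.
(* That the order divides [n] bounds it by [n] only for positive [n], so length 0 is treated
   apart. *)
case: n => [|n] in u v uv *.
  by exists 0; rewrite // rot0 (tuple0 u) (tuple0 v).
have lin : findex (@rot1 n.+1) u v <= n.+1.
  apply: leq_trans (ltnW (findex_max uv)) _.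
  by apply: dvdn_leq => //; apply: order_rot1_dvd.
by exists (findex (@rot1 n.+1) u v); rewrite // -iter_rot1 // iter_findex.
Qed.

(** If [u] is cut into equal blocks [w], rotation by [size w] fixes [u], so the order [p] divides
    [size w] (this is [primp]). Hence the prefix of length [p] is primitive, and every primitive [v]
    having [u] as a power equals that prefix. *)
Lemma has_coperiodE (n : nat) (u : n.-tuple bool) (j : nat) :
  0 < n -> has_coperiod u j <-> j = n %/ order (@rot1 n) u.
Proof.
move=> n0; set p := order _ u.
have p0 : 0 < p by apply: order_gt0.
have p_n : p %| n by apply: order_rot1_dvd.
have lepn : p <= n by apply: dvdn_leq.
have rotp : rot p u = u by apply/eqP; rewrite rot_order_rot1.
have def_pu : tval u = word_pow (take p u) (n %/ p).
  by rewrite /word_pow -{2}(size_tuple u); apply: rot_fixed_flatten; rewrite ?size_tuple.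
have szp : size (take p u) = p by rewrite size_takel ?size_tuple.
have primp w i : 0 < i -> tval u = flatten (nseq i w) -> p %| size w.
  move=> i0 def_u; have szu : n = i * size w.
    by rewrite -size_flatten_nseq -[flatten _]def_u size_tuple.
  rewrite -rot_order_rot1; last by rewrite szu leq_pmull.
  by rewrite def_u rot_flatten_nseq.
split=> [[v prim_v def_u]|->].
  have j0 : 0 < j.
    by case: j def_u => // /(congr1 size); rewrite size_tuple => n_0; rewrite n_0 in n0.
  have szu : n = j * size v by rewrite -size_flatten_nseq -[flatten _]def_u size_tuple.
  have p_v := primp _ _ j0 def_u.
  (* Both factorizations of [u] are truncated to their first [size v] letters; primitivity of [v]
     then excludes an exponent of 2 or more. *)
  have def_v : v = word_pow (take p u) (size v %/ p).
    have lemv : size v %/ p <= n %/ p by rewrite leq_div2r // szu leq_pmull.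
    have := congr1 (take (size v)) (etrans (esym def_u) def_pu).
    rewrite -(prednK j0) /word_pow [flatten (nseq _.+1 v)]/= take_size_cat //.
    rewrite -(subnKC lemv) nseqD flatten_cat take_size_cat //.
    by rewrite size_flatten_nseq szp divnK.
  have eq_vp : p = size v.
    have [m2|] := leqP 2 (size v %/ p); first by case: (prim_v _ _ m2 def_v).
    have v0 : 0 < size v by move: n0; rewrite szu muln_gt0 => /andP[].
    have m0 : 0 < size v %/ p by rewrite divn_gt0 // dvdn_leq.
    move: m0 (divnK p_v); case: (size v %/ p) => [|[|m]] // _ <- _.
    by rewrite mul1n.
  by rewrite eq_vp szu mulnK // -eq_vp.
exists (take p u); last exact: def_pu.
move=> w i i2 def_w; have i0 : 0 < i by apply: ltnW.
have szw : p = i * size w by rewrite -size_flatten_nseq -szp def_w.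
have /primp : tval u = flatten (nseq (n %/ p * i) w).
  by rewrite def_pu def_w /word_pow flatten_nseqM.
have w0 : 0 < size w by move: p0; rewrite szw muln_gt0 => /andP[].
rewrite muln_gt0 divn_gt0 // lepn i0 => /(_ isT) /dvdn_leq -/(_ w0).
by rewrite szw leqNgt ltn_Pmull.
Qed.

Lemma fconnect_order (T : finType) (f : T -> T) (x y : T) :
  injective f -> fconnect f x y -> order f y = order f x.
Proof.
move=> injf fxy; apply: eq_card => w.
by rewrite !inE -(same_connect (fconnect_sym injf) fxy).
Qed.

Lemma fconnect_rot1_count (n : nat) (u v : n.-tuple bool) (a : pred bool) :
  fconnect (@rot1 n) u v -> count a v = count a u.
Proof.
rewrite -rotation_fconnect => /rotationP[i _ ->].
by apply/permP; rewrite perm_rot.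
Qed.

(** * Counting necklaces through their words *)

Lemma necklaces_partition (n : nat) :
  partition (necklaces n) [set: n.-tuple bool].
Proof. by apply: equivalence_partitionP => u v w _ _ _; apply: rotation_equiv. Qed.

Lemma mem_necklace (n : nat) (X : {set n.-tuple bool}) (u v : n.-tuple bool) :
  X \in necklaces n -> u \in X -> (v \in X) = fconnect (@rot1 n) u v.
Proof.
move=> neckX uX; have /and3P[_ tI _] := necklaces_partition n.
rewrite -(def_pblock tI neckX uX) -rotation_fconnect.
rewrite pblock_equivalence_partition ?inE // => x y w _ _ _.
exact: rotation_equiv.
Qed.

(** The number of ones and the order are constant on an orbit, so a single representative decides
    membership. *)
Lemma mem_N_k (r n k : nat) (X : {set n.-tuple bool}) (u : n.-tuple bool) :
  0 < n -> X \in necklaces n -> u \in X ->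
  (X \in N_k r n k)
    = (count_mem true u == k) && (n %/ order (@rot1 n) u %| r).
Proof.
move=> n0 neckX uX; rewrite inE neckX /=; congr (_ && _).
  apply/forall_inP/idP => [|/eqP cu v vX]; first exact.
  by rewrite (@fconnect_rot1_count _ u) ?cu // -(mem_necklace _ neckX uX).
apply/boolp.asboolP/idP => [[j /(_ u uX)]|jr]; first by rewrite has_coperiodE // => ->.
exists (n %/ order (@rot1 n) u) => // v vX; rewrite has_coperiodE //.
rewrite (@fconnect_order _ _ u v) -?(mem_necklace _ neckX uX) //.
exact: rot1_inj.
Qed.

(** A necklace is one orbit: if its words have order [p], there are [p] of them, each of weight
    [n %/ p]. *)
Lemma card_N_k (r n k : nat) :
  0 < n ->
  n * #|N_k r n k|
    = \sum_(u : n.-tuple bool |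
              (count_mem true u == k) && (n %/ order (@rot1 n) u %| r))
        n %/ order (@rot1 n) u.
Proof.
move=> n0; have neckP := necklaces_partition n.
have -> (P : pred (n.-tuple bool)) F :
    \sum_(u | P u) F u = \sum_(u in [set: n.-tuple bool] | P u) F u.
  by apply: eq_bigl => u; rewrite inE.
rewrite (set_partition_big_cond _ neckP) /= mulnC -sum_nat_const.
rewrite [RHS](bigID (mem (N_k r n k))) /= [X in _ = _ + X]big1 ?addn0; last first.
  move=> X /andP[neckX NX]; apply: big1 => u /andP[uX Pu].
  by rewrite (mem_N_k _ _ n0 neckX uX) Pu in NX.
rewrite [RHS](eq_bigl (fun X => X \in N_k r n k)) /=; last first.
  by move=> X; case NX: (X \in N_k r n k); rewrite ?andbF // andbT; case/setIdP: NX.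
apply: eq_bigr => X NX; have neckX : X \in necklaces n by case/setIdP: NX.
have /set0Pn[u uX] : X != set0.
  by apply: contraTneq neckX => ->; case/and3P: neckP.
rewrite (eq_bigl (fun v => v \in X)) => [|v]; last first.
  rewrite andbC; case: (boolP (v \in X)) => vX; rewrite ?andbF // andbT.
  by rewrite -(mem_N_k _ _ n0 neckX vX) NX.
rewrite (eq_bigr (fun=> n %/ order (@rot1 n) u)) => [|v vX]; last first.
  rewrite (@fconnect_order _ _ u v) -?(mem_necklace _ neckX uX) //.
  exact: rot1_inj.
rewrite sum_nat_const (eq_card (fun v => mem_necklace v neckX uX)).
by rewrite mulnC divnK // order_rot1_dvd.
Qed.

(** * Sums and products over roots of unity *)

Local Open Scope ring_scope.

Lemma sum_prim_root (R : idomainType) (n : nat) (z : R) (a : nat) :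
  n.-primitive_root z ->
  \sum_(i < n) z ^+ (i * a) = (if (n %| a)%N then n%:R else 0).
Proof.
move=> prim_z; rewrite (prim_order_dvd prim_z).
under eq_bigr do rewrite mulnC exprM.
case: eqP => [->|/eqP za1].
  under eq_bigr do rewrite expr1n.
  by rewrite sumr_const card_ord.
have := subrX1 (z ^+ a) n; rewrite -exprM mulnC exprM (prim_expr_order prim_z) expr1n subrr.
by move/esym/eqP; rewrite mulf_eq0 subr_eq0 (negPf za1) => /eqP.
Qed.

Lemma sum_multiples (V : nmodType) (p q : nat) (F : nat -> V) :
  (0 < p)%N ->
  \sum_(t < q * p | (p %| t)%N) F t = \sum_(s < q) F (s * p)%N.
Proof.
move=> p0; rewrite big_mkcond /= -(big_mkord xpredT (fun t => if (p %| t)%N then F t else 0)).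
(* In each of the [q] blocks of [p] consecutive indices, only the first is a multiple of [p]. *)
rewrite big_nat_mul big_mkord; apply: eq_bigr => s _.
rewrite big_ltn ?ltn_pmul2r // dvdn_mull // big_nat big1 /= ?addr0 // => t /andP[st ts].
rewrite -(subnKC (ltnW st)) dvdn_addr ?dvdn_mull //.
rewrite gtnNdvd ?subn_gt0 //.
by rewrite -(ltn_add2l (s * p)) (subnKC (ltnW st)) addnC -mulSn.
Qed.

(** Restricting to multiples of [p] replaces [z] by [z ^+ p], a primitive root of order [n %/ p], to
    which the full sum applies. *)
Lemma sum_multiples_prim_root (R : idomainType) (n p : nat) (z : R) (a : nat) :
  n.-primitive_root z -> (p %| n)%N ->
  \sum_(t < n | (p %| t)%N) z ^+ (t * a)
    = (if (n %/ p %| a)%N then (n %/ p)%:R else 0).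
Proof.
move=> prim_z p_n; have n0 := prim_order_gt0 prim_z.
have p0 : (0 < p)%N by apply: dvdn_gt0 p_n.
have prim_zp : (n %/ p).-primitive_root (z ^+ p).
  by rewrite -{1}(gcdn_idPl p_n); apply: exp_prim_root.
have := sum_multiples (n %/ p) (fun t => z ^+ (t * a)) p0.
rewrite divnK // => ->; rewrite -(sum_prim_root a prim_zp).
by apply: eq_bigr => s _; rewrite -exprM mulnA [(p * s)%N]mulnC.
Qed.

Lemma prodXD_prim_root (F : fieldType) (d : nat) (w : F) :
  d.-primitive_root w ->
  \prod_(0 <= i < d) ('X + (w ^+ i.+1)%:P) = 'X^d - ((-1) ^+ d)%:P.
Proof.
move=> prim_w; have d0 := prim_order_gt0 prim_w.
(* The exponents 1, ..., d are shifted to 0, ..., d - 1 using [w ^+ d = 1]. *)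
have -> : \prod_(0 <= i < d) ('X + (w ^+ i.+1)%:P)
        = \prod_(0 <= i < d) ('X + (w ^+ i)%:P).
  case: d d0 prim_w => // d _ prim_w.
  by rewrite big_nat_recr // [RHS]big_nat_recl //= prim_expr_order // mulrC.
(* Substituting [- 'X] in the factorization of ['X^d - 1] flips the sign of each of the [d] factors,
   which is undone by multiplying by [(-1) ^+ d]. *)
have := congr1 (fun p => p \Po - 'X) (factor_Xn_sub_1 prim_w).
rewrite rmorph_prod rmorphB rmorph1 rmorphXn /= comp_polyX.
under eq_bigr do rewrite comp_polyB comp_polyX comp_polyC -opprD -mulN1r.
rewrite big_split /= prodr_const_nat subn0 (exprNn 'X) => eq_prod.
apply: (can_inj (signrMK d)); rewrite eq_prod mulrBr polyC_exp polyCN.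
by rewrite -expr2 sqrr_sign.
Qed.

Lemma prod_prim_root_blocks (F : fieldType) (d g : nat) (w : F) :
  d.-primitive_root w ->
  \prod_(0 <= i < g * d) ('X + (w ^+ i.+1)%:P) = ('X^d - ((-1) ^+ d)%:P) ^+ g.
Proof.
move=> prim_w; rewrite big_nat_mul -(prodXD_prim_root prim_w).
rewrite -[in RHS](subn0 g) -prodr_const_nat; apply: eq_bigr => s _.
rewrite -{1}[(s * d)%N]add0n mulSn big_addn addnK; apply: eq_bigr => i _.
by rewrite -addSn exprD [(s * d)%N]mulnC exprM (prim_expr_order prim_w) expr1n mulr1.
Qed.

(** * Words fixed by a rotation, enumerated by their number of zeros *)

Lemma sum_words_count (R : comNzRingType) (g : nat) (x : R) :
  \sum_(v : g.-tuple bool) x ^+ count_mem false v = (x + 1) ^+ g.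
Proof.
have -> : (x + 1) ^+ g = \prod_(i < g) \sum_(b : bool) (if b then 1 else x).
  by rewrite prodr_const card_ord big_bool addrC.
rewrite bigA_distr_bigA /= (reindex (@finfun_of_tuple _ g)) /=; last first.
  by exists (@tuple_of_finfun _ g) => ? _; rewrite ?tuple_of_finfunK ?finfun_of_tupleK.
apply: eq_bigr => v _.
have -> : x ^+ count_mem false v = \prod_(b <- v) (if b then 1 else x).
  elim: (tval v) => [|b s IHs] /=; first by rewrite big_nil.
  by rewrite big_cons exprD IHs; case: b.
by rewrite big_tuple; apply: eq_bigr => i _; rewrite ffunE.
Qed.

Lemma sum_rot_fixed_words (R : comNzRingType) (n t : nat) (x : R) :
  (0 < n)%N ->
  \sum_(u : n.-tuple bool | (order (@rot1 n) u %| t)%N) x ^+ count_mem false u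
    = (x ^+ (n %/ gcdn t n) + 1) ^+ gcdn t n.
Proof.
move=> n0; set g := gcdn t n; set d := (n %/ g)%N.
have g0 : (0 < g)%N by rewrite gcdn_gt0 n0 orbT.
have g_n : (g %| n)%N by apply: dvdn_gcdr.
have def_n : (d * g = n)%N by apply: divnK.
have d0 : (0 < d)%N by rewrite divn_gt0 // dvdn_leq.
(* The order divides [n], so it divides [t] exactly when it divides [g]; unlike [t], [g] is known to
   be at most [n]. *)
have fixP (u : n.-tuple bool) : (order (@rot1 n) u %| t)%N = (rot g u == u).
  by rewrite (rot_order_rot1 u (dvdn_leq n0 g_n)) dvdn_gcd order_rot1_dvd andbT.
rewrite (eq_bigl _ _ fixP).
have sz_h (v : g.-tuple bool) : size (flatten (nseq d (tval v))) == n.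
  by rewrite size_flatten_nseq size_tuple def_n.
have sz_h' (u : n.-tuple bool) : size (take g u) == g.
  by rewrite size_takel // size_tuple dvdn_leq.
(* Repeating a word of length [g] and taking the prefix of length [g] are inverse bijections onto
   and from the fixed words. *)
pose h v := Tuple (sz_h v); pose h' u := Tuple (sz_h' u).
rewrite (reindex_onto h h') => [|u /eqP rot_u]; last first.
  apply: val_inj => /=; have := @rot_fixed_flatten _ u g.
  by rewrite size_tuple => /(_ g_n rot_u) <-.
rewrite -(sum_words_count g (x ^+ d)) (eq_bigl predT) => [|v] /=; last first.
  rewrite -[X in rot X _](size_tuple v) rot_flatten_nseq eqxx /=.
  apply/eqP/val_inj => /=; rewrite -(prednK d0) /= take_size_cat //.
  exact: size_tuple.
apply: eq_bigr => v _; rewrite count_flatten map_nseq sumn_nseq.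
by rewrite mulnC exprM.
Qed.

(** * Comparison of the two coefficients *)

Lemma coef_XnD_exp (R : comNzRingType) (d g m : nat) (c : R) :
  (0 < d)%N -> ~~ (d %| m)%N -> (('X^d + c%:P) ^+ g)`_m = 0.
Proof.
move=> d0 /negPf ndm.
have -> : ('X^d + c%:P) ^+ g = (('X + c%:P) ^+ g) \Po 'X^d.
  by rewrite rmorphXn /= comp_polyD comp_polyX comp_polyC.
by rewrite coef_comp_poly_Xn // ndm.
Qed.

(** Expanding the product, [A] is the set of factors from which the constant is chosen; the others
    contribute ['X^(n - #|A|)]. *)
Lemma sum_subsets_coef (R : comNzRingType) (n k : nat) (w : R) :
  (k <= n)%N ->
  \sum_(A : {set 'I_n} | #|A| == k) w ^+ (\sum_(i in A) i.+1)
    = (\prod_(0 <= i < n) ('X + (w ^+ i.+1)%:P))`_(n - k).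
Proof.
move=> lekn; rewrite big_mkord.
under [in RHS]eq_bigr do rewrite addrC.
rewrite bigA_distr coef_sum big_mkcond /=; apply: eq_bigr => A _.
have -> : \prod_(i < n) (if i \in A then (w ^+ i.+1)%:P else 'X)
          = (w ^+ (\sum_(i in A) i.+1))%:P * 'X^(n - #|A|).
  rewrite (bigID (mem A)) /=; congr (_ * _).
    by rewrite -prodrXr rmorph_prod; apply: eq_bigr => i ->.
  have -> : (n - #|A| = #|~: A|)%N by rewrite [RHS]cardsCs setCK card_ord.
  rewrite -prodr_const.
  by apply: eq_big => [i|i /negPf->] //; rewrite inE.
rewrite coefCM coefXn.
have leAn : (#|A| <= n)%N by rewrite -[X in (_ <= X)%N]card_ord max_card.
have -> : (n - k == n - #|A|)%N = (#|A| == k).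
  by rewrite -(eqn_add2r k) subnK // -{1}(subnK leAn) eqn_add2l eq_sym.
by case: eqP; rewrite ?mulr1 ?mulr0.
Qed.

Lemma fixed_words_subsets (n k t : nat) (z : algC) :
  n.-primitive_root z -> (k <= n)%N -> odd n || odd k ->
  \sum_(A : {set 'I_n} | #|A| == k) z ^+ (t * \sum_(i in A) i.+1)
    = #|[set u : n.-tuple bool | (count_mem true u == k)
                                 && (order (@rot1 n) u %| t)%N]|%:R.
Proof.
move=> prim_z lekn odd_nk; have n0 := prim_order_gt0 prim_z.
have prim_w := exp_prim_root prim_z t.
set g := gcdn t n in prim_w; set d := (n %/ g)%N in prim_w.
have d0 : (0 < d)%N := prim_order_gt0 prim_w.
have def_n : (g * d = n)%N by rewrite mulnC divnK // dvdn_gcdr.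
under eq_bigr do rewrite exprM.
rewrite sum_subsets_coef // -{1}def_n prod_prim_root_blocks //.
transitivity ((('X^d + 1 : {poly algC}) ^+ g)`_(n - k)).
  (* For odd [d] the two polynomials coincide. *)
  case odd_d: (odd d); first by rewrite -signr_odd odd_d polyCN opprK.
  have odd_k : odd k by move: odd_nk; rewrite -def_n oddM odd_d andbF.
  (* Here [d] and [n] are even and [k] is odd, so [n - k] is odd. *)
  have ndk : ~~ (d %| n - k)%N.
    have d2 : (2 %| d)%N by rewrite dvdn2 odd_d.
    apply/negP=> /(dvdn_trans d2); rewrite dvdn2 oddB // odd_k addbT negbK.
    by rewrite -def_n oddM odd_d andbF.
  by rewrite -polyCN -polyC1 !coef_XnD_exp.
(* With ['X] marking zeros, the words with [k] ones are those of degree [n - k]. *)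
rewrite -sum_rot_fixed_words // coef_sum -sum1_card natr_sum big_mkcond /=.
rewrite [RHS]big_mkcond; apply: eq_bigr => u _; rewrite inE andbC.
case: ifP => //= _; rewrite coefXn.
have cu : (count_mem true u + count_mem false u = n)%N.
  rewrite -[RHS](size_tuple u) -(count_predC (pred1 true)); congr (_ + _)%N.
  by apply: eq_count => -[].
have -> : (n - k == count_mem false u)%N = (count_mem true u == k).
  by rewrite -(eqn_add2r k) subnK // -{1}cu addnC eqn_add2l.
by case: eqP.
Qed.

(** * The root-of-unity filter for the residue [r] *)

Lemma card_Sbar_N_k (n r k : nat) :
  (0 < n)%N -> (r < n)%N -> (k <= n)%N -> odd n || odd k ->
  #|Sbar_k r n k| = #|N_k r n k|.
Proof.
move=> n0 ltrn lekn odd_nk; have [z prim_z] := C_prim_root_exists n0.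
apply/eqP; rewrite -(eqn_pmul2l n0) card_N_k // -(eqr_nat algC); apply/eqP.
(* This is the inverse of [z ^+ (t * r)], written with a natural exponent. *)
pose W := fun t : nat => z ^+ (t * (n - r)).
transitivity (\sum_(t < n) W t *
    #|[set u : n.-tuple bool | (count_mem true u == k)
                               && (order (@rot1 n) u %| t)%N]|%:R).
  under [RHS]eq_bigr do rewrite -(fixed_words_subsets _ prim_z lekn odd_nk) mulr_sumr.
  rewrite exchange_big /= natrM -sum1_card natr_sum mulr_sumr big_mkcond [RHS]big_mkcond.
  apply: eq_bigr => A _; rewrite inE; case: eqP => //= _.
  under [RHS]eq_bigr do rewrite -exprD -mulnDr.
  (* The sum over [t] detects that [n] divides [n - r] plus the sum of [A], that is, that this sum
     is [r] modulo [n]. *)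
  rewrite sum_prim_root // mulr1 -(eqn_modDr (n - r)) subnKC 1?ltnW // modnn.
  by rewrite addnC.
under eq_bigr do rewrite -sum1_card natr_sum mulr_sumr big_mkcond.
rewrite exchange_big natr_sum /= [RHS]big_mkcond; apply: eq_bigr => u _.
have p_n := order_rot1_dvd u.
transitivity (if count_mem true u == k
    then \sum_(t < n | (order (@rot1 n) u %| t)%N) W t else 0).
  case: ifP => cu; last by apply: big1 => t _; rewrite inE cu.
  by rewrite [RHS]big_mkcond; apply: eq_bigr => t _; rewrite inE cu /= mulr1.
rewrite sum_multiples_prim_root //; case: ifP => //= _.
(* As the co-period divides [n], it divides [n - r] exactly when it divides [r]. *)
by rewrite dvdn_subr // ?dvdn_div // ltnW.
Qed.

(** * Union over all sizes [k] *)

Lemma card_bigcup_disjoint (T : finType) (m : nat) (F : 'I_m -> {set T}) :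
  (forall i j x, x \in F i -> x \in F j -> i = j) ->
  #|\bigcup_i F i| = (\sum_i #|F i|)%N.
Proof.
move=> disjF.
have memF i0 x : x \in F i0 -> (\sum_i (x \in F i) = 1)%N.
  move=> x0; rewrite (bigD1 i0) //= x0 big1 // => j ji.
  by apply/eqP; rewrite eqb0; apply: contra ji => xj; rewrite (disjF _ _ _ xj x0).
under [RHS]eq_bigr do rewrite -sum1_card big_mkcond.
rewrite exchange_big -sum1_card big_mkcond /=; apply: eq_bigr => x _.
rewrite (eq_bigr (fun i => nat_of_bool (x \in F i))) => [|i _]; last by case: ifP.
case: bigcupP => [[i _ /memF->//]|nx]; rewrite big1 // => i _.
by case: (boolP (x \in F i)) => // xi; case: nx; exists i.
Qed.

Local Close Scope ring_scope.

Theorem theorem4p6 (n r : nat) (hn : 1 <= n) (hr : r < n) :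
  (forall k : nat, k <= n -> odd n || odd k ->
     #|Sbar_k r n k| = #|N_k r n k|) /\
  (odd n -> #|Sbar r n| = #|N_all r n|).
Proof.
split=> [k|odd_n]; first exact: card_Sbar_N_k.
rewrite /Sbar /N_all !card_bigcup_disjoint.
- by apply: eq_bigr => k _; rewrite card_Sbar_N_k ?odd_n // -ltnS.
- move=> i j X Xi Xj; have /setIdP[neckX _] := Xi.
  (* A necklace contains a word, whose number of ones determines [k]; this makes the sets [N_k]
     disjoint. *)
  have /set0Pn[u uX] : X != set0.
    by apply: contraTneq neckX => ->; case/and3P: (necklaces_partition n).
  move: Xi Xj; rewrite !(mem_N_k _ _ _ neckX uX) // => /andP[/eqP cu _] /andP[/eqP cu' _].
  by apply: val_inj; rewrite /= -cu -cu'.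
- move=> i j A; rewrite !inE => /andP[/eqP cA _] /andP[/eqP cA' _].
  by apply: val_inj; rewrite /= -cA -cA'.
Qed.
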